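(* Let $q>p>1$ be reals and $C\in(0,1)$. Consider all probability vectors $\vec w=(w_1,w_2,\dots)$ (with countably many entries $w_i\geq 0$, $i\geq 1$, and $\sum_i w_i=1$) satisfying $\sum_i w_i^p=C$. Then the minimum of $\sum_i w_i^q$ over all such vectors exists and equals $f_{p,q}(C)$, and it is attained by a vector with $w_1=w_2=\cdots=w_m>w_{m+1}\geq 0$ and $w_i=0$ for all $i\geq m+2$, for some $m$.
   Context: For reals $q>p>1$, the function $f_{p,q}:[0,1]\to[0,1]$ is defined by $f_{p,q}(0)=0$ and, for every $z\in(0,1]$, $$f_{p,q}\big(\lfloor z^{-1}\rfloor z^p+(1-\lfloor z^{-1}\rfloor z)^p\big)=\lfloor z^{-1}\rfloor z^q+(1-\lfloor z^{-1}\rfloor z)^q;$$ this is well defined since $z\mapsto \lfloor z^{-1}\rfloor z^p+(1-\lfloor z^{-1}\rfloor z)^p$ is a strictly increasing continuous bijection from $(0,1]$ onto $(0,1]$. *)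

(* Defs.v *)
From HB Require Import structures.
From mathcomp Require Import all_boot all_order all_algebra.
From mathcomp Require Import all_classical all_reals all_analysis.
From mathcomp Require Import ring lra.

Set Implicit Arguments.
Unset Strict Implicit.
Unset Printing Implicit Defensive.

Import Order.TTheory GRing.Theory Num.Theory.
Import numFieldNormedType.Exports.

Local Open Scope classical_set_scope.
Local Open Scope ring_scope.

Section definitions.
Context {R : realType}.
Implicit Types (p q C x z : R) (w : nat -> R).

(* p-th power sum of the vector with floor(1/z) entries equal to z and one
   further entry 1 - floor(1/z) * z in [0, z[. *)
Definition phi p z : R :=
  (Num.floor z^-1)%:~R * z `^ p + (1 - (Num.floor z^-1)%:~R * z) `^ p.

(* Only the values on [0, 1] are meaningful; [fpq_phi] below is the equation
   that defines the function there. *)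
Definition fpq p q x : R :=
  if x == 0 then 0
  else phi q (xget 0 [set z | 0 < z <= 1 /\ phi p z = x]).

(* Vectors are indexed from 0: [w i] is the entry w_{i+1}. *)
Definition prob_vector w : Prop :=
  (forall i, 0 <= w i) /\ (\sum_(0 <= i <oo) (w i)%:E = 1)%E.

Definition power_sum p w : \bar R := (\sum_(0 <= i <oo) (w i `^ p)%:E)%E.

Definition admissible p C w : Prop :=
  prob_vector w /\ power_sum p w = C%:E.

End definitions.

Section well_defined.
Context {R : realType}.
Implicit Types (p q x y z k : R).

Let powR_tangent p x y : 1 < p -> 0 <= x -> 0 <= y ->
  x `^ p + p * x `^ (p - 1) * (y - x) <= y `^ p.
Proof.
move=> p1 x0 y0.
have p0 : 0 < p by lra.
have pm : 0 < p - 1 by lra.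
have pn : p != 0 by lra.
have pmn : p - 1 != 0 by lra.
have := @conjugate_powR R y (x `^ (p - 1)) p (p / (p - 1)) y0 (powR_ge0 _ _) p0.
rewrite divr_gt0// => /(_ isT).
have -> : p^-1 + (p / (p - 1))^-1 = 1 by field; rewrite pn pmn.
move=> /(_ erefl).
rewrite -powRrM (_ : (p - 1) * (p / (p - 1)) = p); last by field.
rewrite -(ler_pM2r p0).
have -> : (y `^ p / p + x `^ p / (p / (p - 1))) * p = y `^ p + (p - 1) * x `^ p.
  by field; rewrite pn pmn.
rewrite -(@mulr_powRB1 _ x p)//; set a := x `^ (p - 1) => h; nra.
Qed.

Let H p k x := k * x `^ p + (1 - k * x) `^ p.

Let H_diff p k x y : 1 < p -> 0 < k -> 0 <= x -> x <= y -> k * y <= 1 ->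
  p * k * (y - x) * (x `^ (p - 1) - (1 - k * x) `^ (p - 1)) <= H p k y - H p k x.
Proof.
move=> p1 k0 x0 xy ky.
have y0 : 0 <= y by lra.
have kxy : k * x <= k * y by rewrite ler_pM2l.
have h1 := powR_tangent p1 x0 y0.
have a0 : 0 <= 1 - k * x by lra.
have b0 : 0 <= 1 - k * y by lra.
have h2 := powR_tangent p1 a0 b0.
rewrite -(ler_pM2l k0) in h1.
rewrite /H; move: h1 h2.
set u := x `^ (p - 1); set v := (1 - k * x) `^ (p - 1); lra.
Qed.

Let H_le p k x y : 1 < p -> 0 < k -> 0 <= x -> x <= y -> k * y <= 1 ->
  1 - k * x <= x -> H p k x <= H p k y.
Proof.
move=> p1 k0 x0 xy ky ax; rewrite -subr_ge0.
have kxy : k * x <= k * y by rewrite ler_pM2l.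
apply: le_trans (H_diff p1 k0 x0 xy ky).
rewrite mulr_ge0// ?subr_ge0//; first by rewrite !mulr_ge0//; lra.
by apply: ge0_ler_powR; rewrite ?nnegrE//; lra.
Qed.

Let H_lt p k x y : 1 < p -> 0 < k -> 0 <= x -> x < y -> k * y <= 1 ->
  1 - k * x < x -> H p k x < H p k y.
Proof.
move=> p1 k0 x0 xy ky ax; rewrite -subr_gt0.
have kxy : k * x < k * y by rewrite ltr_pM2l.
apply: lt_le_trans (H_diff p1 k0 x0 (ltW xy) ky).
rewrite mulr_gt0// ?subr_gt0//; first by rewrite !mulr_gt0//; lra.
by apply: gt0_ltr_powR; rewrite ?nnegrE//; lra.
Qed.

Let floor_inv z : 0 < z <= 1 -> let n := Num.floor z^-1 in
  [/\ 1 <= n, 1 <= n%:~R :> R, n%:~R * z <= 1 & 1 < (n%:~R + 1) * z].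
Proof.
move=> /andP[z0 z1] n.
have n1 : 1 <= n by rewrite /n floor_ge_int invf_ge1.
split => //; first by rewrite ler1z.
- by rewrite -ler_pdivlMr// div1r floor_le.
- by rewrite -ltr_pdivrMr// div1r -[1 in ltRHS]/(1%:~R) -intrD floorD1_gt.
Qed.

Lemma phi_lt p x y : 1 < p -> 0 < x -> x < y -> y <= 1 -> phi p x < phi p y.
Proof.
move=> p1 x0 xy y1; have y0 : 0 < y := lt_trans x0 xy.
have xI : 0 < x <= 1 by rewrite x0/=; lra.
have yI : 0 < y <= 1 by rewrite y0.
have [m1 m1' mx mx'] := floor_inv xI; have [n1 n1' ny ny'] := floor_inv yI.
have nm : Num.floor y^-1 <= Num.floor x^-1.
  by rewrite le_floor// lef_pV2// ltW.
rewrite /phi; move: (Num.floor x^-1) (Num.floor y^-1) m1 m1' mx mx' n1 n1' ny ny' nm.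
move=> m n m1 m1' mx mx' n1 n1' ny ny'.
rewrite le_eqVlt => /predU1P[nm|nm].
  by subst n; apply: H_lt => //; lra.
have nm' : n%:~R + 1 <= m%:~R :> R.
  by rewrite -[1 in leLHS]/(1%:~R) -intrD ler_int lezD1.
move: {m1 n1 nm} (m%:~R : R) (n%:~R : R) m1' mx mx' n1' ny ny' nm' => {m n}.
move=> m n m1 mx mx' n1 ny ny' nm.
have mn0 : m != 0 by lra.
have nn0 : n + 1 != 0 by lra.
have e : n * (n + 1)^-1 + (n + 1)^-1 = 1 by field.
have i0 : 0 < (n + 1)^-1 by rewrite invr_gt0; lra.
have iy : (n + 1)^-1 < y by rewrite -[ltLHS]mul1r ltr_pdivrMr ?(mulrC y)//; lra.
have hx : H p m x <= H p m m^-1.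
  apply: H_le => //; try lra.
  - by rewrite -[leRHS]mul1r ler_pdivlMr ?(mulrC x)//; lra.
  - by rewrite mulfV.
have hy : H p n (n + 1)^-1 < H p n y.
  pose c := (y + (n + 1)^-1) / 2.
  have cy : c < y by rewrite /c; lra.
  have ic : (n + 1)^-1 < c by rewrite /c; lra.
  have nc : n * c < n * y by rewrite ltr_pM2l//; lra.
  have nic : n * (n + 1)^-1 < n * c by rewrite ltr_pM2l//; lra.
  apply: (@le_lt_trans _ _ (H p n c)); last by apply: H_lt => //; lra.
  by apply: H_le => //; lra.
apply: le_lt_trans hx (le_lt_trans _ hy).
have diag k : 0 < k -> k * k^-1 `^ p = k^-1 `^ (p - 1).
  move=> k0; have k1 : 0 <= k^-1 by rewrite invr_ge0 ltW.
  rewrite -(mulr_powRB1 k1); last lra.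
  by rewrite mulrA mulfV ?mul1r// gt_eqF.
rewrite /H mulfV// subrr powR0; last lra.
rewrite addr0 diag; last lra.
have -> : 1 - n * (n + 1)^-1 = (n + 1)^-1 by lra.
have -> : n * (n + 1)^-1 `^ p + (n + 1)^-1 `^ p = (n + 1) * (n + 1)^-1 `^ p.
  by ring.
rewrite diag; last lra.
apply: ge0_ler_powR; rewrite ?nnegrE ?invr_ge0 ?lef_pV2 ?posrE//; lra.
Qed.

Lemma fpq0 p q : fpq p q 0 = 0.
Proof. by rewrite /fpq eqxx. Qed.

Lemma fpq_phi p q z : 1 < p -> 0 < z <= 1 -> fpq p q (phi p z) = phi q z.
Proof.
move=> p1 zI; have [n1 n1' nz nz'] := floor_inv zI.
have /andP[z0 z1] := zI.
have pz : 0 < phi p z.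
  rewrite /phi ltr_wpDr ?powR_ge0// mulr_gt0 ?powR_gt0//; lra.
rewrite /fpq gt_eqF//; congr phi.
case: xgetP => [y _ [/andP[y0 y1] yz]|/(_ z)/(_ (conj zI erefl))//].
by case: (ltgtP y z) => // h; [have := phi_lt p1 y0 h z1|have := phi_lt p1 z0 h y1];
  rewrite yz ltxx.
Qed.

End well_defined.

(* Main.v *)
(** The extremal vectors consist of equal entries z and one remainder r <= z.
    Three values x >= y >= r with multiplicities a, b, 1 can be moved to values
    r' <= r, y <= y' <= x' <= x with the same sum and p-th power sum, until
    x' = y' or r' = 0, and such a move does not increase the q-th power sum
    (the equal variable principle). Hence an extremal vector enlarged by one
    entry is brought back to extremal form by finitely many moves, and by
    induction every finite vector is dominated by an extremal one; no
    compactness is needed. For an infinite vector, lump the entries from index n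
    on into one: this can only increase the p-th power sum, the extremal q-th
    power sum is monotone in the p-th one, and the lumped entry vanishes as n
    grows. *)

Require Import Defs.
From mathcomp Require Import all_boot all_order all_algebra.
From mathcomp Require Import all_classical all_reals all_analysis.
From mathcomp Require Import ring lra.

Set Implicit Arguments.
Unset Strict Implicit.
Unset Printing Implicit Defensive.

Import Order.TTheory GRing.Theory Num.Theory.
Import numFieldNormedType.Exports.
Local Open Scope classical_set_scope.
Local Open Scope ring_scope.

(** * Convexity inequalities, mean values and intermediate values for real powers *)

Section power_function.
Context {R : realType}.
Implicit Types (p q x y z a b c u v : R).

Lemma powR_tangent p x y : 1 < p -> 0 <= x -> 0 <= y ->
  x `^ p + p * x `^ (p - 1) * (y - x) <= y `^ p.
Proof.
move=> p1 x0 y0.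
have pn : p != 0 by lra.
have qn : p - 1 != 0 by lra.
have := @conjugate_powR R y (x `^ (p - 1)) p (p / (p - 1)) y0 (powR_ge0 _ _).
have -> : p^-1 + (p / (p - 1))^-1 = 1 by field; rewrite pn qn.
move=> /(_ ltac:(lra) ltac:(by rewrite divr_gt0; lra) erefl).
rewrite -powRrM (_ : (p - 1) * (p / (p - 1)) = p); last by field.
have p0 : 0 < p by lra.
rewrite -(ler_pM2r p0) mulrDl mulfVK// (_ : _ / _ * p = (p - 1) * x `^ p);
  last by field; rewrite pn qn.
by rewrite -(mulr_powRB1 x0 p0); lra.
Qed.

Lemma powR_le p x y : 0 <= p -> 0 <= x -> x <= y -> x `^ p <= y `^ p.
Proof.
by move=> p0 x0 xy; apply: ge0_ler_powR; rewrite ?nnegrE// (le_trans x0).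
Qed.

(** The tangent at [b] bounds the powers of [a] and [c] from below; the weights [c - b] and [b - a]
    cancel its slope. *)
Lemma powR_chord p a b c : 1 < p -> 0 <= a -> a <= b -> b <= c ->
  b `^ p * (c - a) <= a `^ p * (c - b) + c `^ p * (b - a).
Proof.
move=> p1 a0 ab bc.
have b0 : 0 <= b by lra.
have c0 : 0 <= c by lra.
have cb : 0 <= c - b by lra.
have ba : 0 <= b - a by lra.
have := ler_wpM2r cb (powR_tangent p1 b0 a0).
have := ler_wpM2r ba (powR_tangent p1 b0 c0).
move: (b `^ (p - 1)) (a `^ p) (b `^ p) (c `^ p) => B A' B' C'.
lra.
Qed.

(* [t `^ (q - 1)] is a convex function of [t `^ (p - 1)]. *)
Lemma powR_chord2 p q a b c : 1 < p -> p < q -> 0 <= a -> a <= b -> b <= c ->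
  b `^ (q - 1) * (c `^ (p - 1) - a `^ (p - 1)) <=
  a `^ (q - 1) * (c `^ (p - 1) - b `^ (p - 1)) +
  c `^ (q - 1) * (b `^ (p - 1) - a `^ (p - 1)).
Proof.
move=> p1 pq a0 ab bc.
have qE t : t `^ (q - 1) = (t `^ (p - 1)) `^ ((q - 1) / (p - 1)) :> R.
  by rewrite -powRrM mulrC mulfVK//; lra.
have b0 : 0 <= b by lra.
rewrite !qE; apply: powR_chord; rewrite ?powR_ge0// ?powR_le//; try lra.
by rewrite ltr_pdivlMr; lra.
Qed.

(** The absolute value gives a function continuous on the whole line, from which continuity on
    segments starting at 0 follows by restriction. *)
Lemma continuous_powR_norm q : 0 < q -> continuous (fun t : R => `|t| `^ q).
Proof.
move=> q0 x; have [->|x0] := eqVneq x 0.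
  apply/cvgrPdist_lt => e e0; near=> t.
  rewrite normr0 powR0 ?gt_eqF// sub0r normrN ger0_norm ?powR_ge0//.
  have -> : e = (e `^ q^-1) `^ q.
    by rewrite -powRrM mulVf ?gt_eqF// powRr1// ltW.
  apply: gt0_ltr_powR => //; rewrite ?nnegrE ?powR_ge0//.
  near: t; have := @cvgr0_norm_lt R R R (nbhs 0) _ id cvg_id.
  by apply; rewrite powR_gt0.
have hx : {for `|x|, continuous (@powR R ^~ q)}.
  apply/differentiable_continuous/derivable1_diffP/derivable_powR.
  by rewrite in_itv/= andbT normr_gt0.
have nx : {for x, continuous (fun t : R => `|t|)} by exact: norm_continuous.
exact: (continuous_comp nx hx).
Unshelve. all: end_near. Qed.

Lemma powR_combination_MVT p q u v k a b : 0 < p -> 0 < q -> 0 <= a -> a <= b ->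
  let g t := k * t `^ q - (u * t + v * t `^ p) in
  exists2 c, a <= c <= b & g b - g a =
    (k * (q * c `^ (q - 1)) - (u + v * (p * c `^ (p - 1)))) * (b - a).
Proof.
move=> p0 q0 a0 ab g.
pose dg c := k * (q * c `^ (q - 1)) - (u + v * (p * c `^ (p - 1))).
have [x||c cab e] := @MVT_segment R g dg a b ab.
- rewrite in_itv/= => /andP[ax _].
  have x0 : 0 < x by exact: le_lt_trans ax.
  have dq := is_derive1_powR q x0; have dp := is_derive1_powR p x0.
  rewrite /g /dg.
  have := is_deriveB (is_deriveZ k dq)
    (is_deriveD (is_deriveZ u (is_derive_id x 1)) (is_deriveZ v dp)).
  by rewrite /GRing.scale/= mulr1.
- pose h t : R := k * `|t| `^ q - (u * t + v * `|t| `^ p).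
  have hc : continuous h.
    move=> x; apply: cvgB.
      by apply: cvgM; [exact: cvg_cst|exact: continuous_powR_norm].
    apply: cvgD; apply: cvgM; [exact: cvg_cst|exact: cvg_id|exact: cvg_cst|].
    exact: continuous_powR_norm.
  apply: subspace_eq_continuous (continuous_subspaceT hc).
  move=> x; rewrite inE/= in_itv/= => /andP[ax _].
  by rewrite /h /g/from_subspace/= ger0_norm// (le_trans a0).
- by exists c => //; rewrite in_itv in cab.
Qed.

(** When the sum is fixed, one value is an affine function of another; this finds the position with
    a prescribed p-th power sum. *)
Lemma powR_combination_IVT p u v k l a b P : 0 < p -> 0 <= a -> a <= b ->
  (forall t, a <= t <= b -> 0 <= u + v * t) ->
  let f t := k * (u + v * t) `^ p + l * t `^ p in
  (f a <= P <= f b) || (f b <= P <= f a) ->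
  exists2 c, a <= c <= b & f c = P.
Proof.
move=> p0 a0 ab uv f fP.
pose h t : R := k * `|u + v * t| `^ p + l * `|t| `^ p.
have fh t : a <= t <= b -> f t = h t.
  move=> tab; have t0 : 0 <= t by case/andP: tab => at_ _; exact: le_trans at_.
  by rewrite /f /h !ger0_norm ?uv.
have hc : continuous h.
  move=> x; apply: cvgD; apply: cvgM; [exact: cvg_cst| |exact: cvg_cst|].
  - have ac : {for x, continuous (fun t : R => u + v * t)}.
      apply: cvgD; [exact: cvg_cst|apply: cvgM; [exact: cvg_cst|exact: cvg_id]].
    exact: (continuous_comp ac (@continuous_powR_norm p p0 _)).
  - exact: continuous_powR_norm.
have [|c cab e] := @IVT R h a b P ab (continuous_subspaceT hc).
- rewrite -!fh ?lexx ?ab//.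
  by rewrite ge_min le_max; case/orP: fP => /andP[-> ->]; rewrite ?orbT.
by rewrite in_itv in cab; exists c => //; rewrite fh.
Qed.

End power_function.

(** * The equal variable principle for three values with multiplicities *)

Section smoothing.
Context {R : realType}.
Implicit Types (p q a b x y r z S P Q : R).

(* If x' > x, the tangent inequalities make the p-th power sum of the primed
   triple too large. *)
Lemma contraction_le p a b x y r x' y' r' : 1 < p -> 0 < a -> 0 < b ->
  0 <= r' -> r' <= r -> r <= y -> y < x -> y <= y' -> y' <= x' ->
  a * x' + b * y' + r' = a * x + b * y + r ->
  a * x' `^ p + b * y' `^ p + r' `^ p = a * x `^ p + b * y `^ p + r `^ p ->
  x' <= x.
Proof.
move=> p1 a0 b0 r'0 r'r ry yx yy' yx' sE pE; rewrite leNgt; apply/negP => xx'.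
have p0 : 0 < p by lra.
have x0 : 0 <= x by lra.
have x'0 : 0 <= x' by lra.
have y0 : 0 <= y by lra.
have y'0 : 0 <= y' by lra.
have r0 : 0 <= r by lra.
have hx := powR_tangent p1 x0 x'0; rewrite -(ler_pM2l a0) in hx.
have hy := powR_tangent p1 y0 y'0; rewrite -(ler_pM2l b0) in hy.
have hr := powR_tangent p1 r0 r'0.
have XY : y `^ (p - 1) < x `^ (p - 1).
  by apply: gt0_ltr_powR; rewrite ?nnegrE//; lra.
have YR : r `^ (p - 1) <= y `^ (p - 1) by apply: powR_le => //; lra.
move: XY YR hx hy hr; rewrite -subr_gt0 -[_ <= _]subr_ge0.
move: (x `^ (p - 1)) (y `^ (p - 1)) (r `^ (p - 1)) => X Y Z XY YZ hx hy hr.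
have U0 : 0 < p * ((X - Y) * (a * (x' - x))).
  by rewrite !mulr_gt0// subr_gt0.
have W0 : 0 <= p * ((Y - Z) * (r - r')).
  by rewrite !mulr_ge0// ?subr_ge0//; lra.
(* The right side is the first-order change of the p-th power sum; equal sums make it a positive
   term plus a nonnegative one. *)
have E : p * ((X - Y) * (a * (x' - x))) + p * ((Y - Z) * (r - r')) =
   p * X * (a * (x' - x)) + p * Y * (b * (y' - y)) - p * Z * (r - r').
  have -> : r - r' = a * (x' - x) + b * (y' - y) by lra.
  ring.
lra.
Qed.

(* Choose u, v such that t `^ q - u * t - v * t `^ p has derivative zero at y
   and x'. By convexity of t `^ (q - 1) in t `^ (p - 1), that function is
   nonincreasing on [y, x'] and nondecreasing on both sides of it, so that each
   coordinate move r -> r', y -> y', x -> x' decreases it. *)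
Lemma contraction_powR_le p q a b x y r x' y' r' : 1 < p -> p < q ->
  0 < a -> 0 < b ->
  0 <= r' -> r' <= r -> r <= y -> y < x -> y <= y' -> y' <= x' ->
  a * x' + b * y' + r' = a * x + b * y + r ->
  a * x' `^ p + b * y' `^ p + r' `^ p = a * x `^ p + b * y `^ p + r `^ p ->
  a * x' `^ q + b * y' `^ q + r' `^ q <= a * x `^ q + b * y `^ q + r `^ q.
Proof.
move=> p1 pq a0 b0 r'0 r'r ry yx yy' yx' sE pE.
have x'x := contraction_le p1 a0 b0 r'0 r'r ry yx yy' yx' sE pE.
have p0 : 0 < p by lra.
have q0 : 0 < q by lra.
have y0 : 0 <= y by lra.
have yltx' : y < x'.
  rewrite ltNge; apply/negP => x'y.
  have : 0 < a * (x - x') by rewrite mulr_gt0// subr_gt0; lra.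
  have -> : a * (x - x') = r' - r + b * (y' - y) by lra.
  have -> : y' = y by lra.
  lra.
pose s1 := y `^ (p - 1); pose s2 := x' `^ (p - 1).
pose S1 := y `^ (q - 1); pose S2 := x' `^ (q - 1).
have s12 : 0 < s2 - s1.
  by rewrite subr_gt0; apply: gt0_ltr_powR; rewrite ?nnegrE//; lra.
(* Cramer's rule for the two derivative conditions, with everything multiplied by the determinant
   factor [s2 - s1 > 0]. *)
pose u := q * (S1 * s2 - S2 * s1); pose v := q * (S2 - S1) / p.
pose g t := (s2 - s1) * t `^ q - (u * t + v * t `^ p).
have dgE c : (s2 - s1) * (q * c `^ (q - 1)) - (u + v * (p * c `^ (p - 1))) =
    q * (c `^ (q - 1) * (s2 - s1) - S1 * (s2 - c `^ (p - 1))
         - S2 * (c `^ (p - 1) - s1)).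
  by rewrite /u /v; field; lra.
have gE t t' : 0 <= t -> t <= t' -> exists2 c, t <= c <= t' & g t' - g t =
    q * (c `^ (q - 1) * (s2 - s1) - S1 * (s2 - c `^ (p - 1))
         - S2 * (c `^ (p - 1) - s1)) * (t' - t).
  move=> t0 tt'.
  have [c ctt' e] := powR_combination_MVT u v (s2 - s1) p0 q0 t0 tt'.
  by exists c => //; rewrite -dgE.
have gr : 0 <= g r - g r'.
  have [c /andP[c1 c2] ->] := gE _ _ r'0 r'r.
  rewrite mulr_ge0 ?subr_ge0// pmulr_rge0//.
  have := powR_chord2 p1 pq (le_trans r'0 c1) (le_trans c2 ry) (ltW yltx').
  by rewrite -/s1 -/s2 -/S1 -/S2; lra.
have gy : 0 <= g y - g y'.
  rewrite -opprB oppr_ge0.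
  have [c /andP[c1 c2] ->] := gE _ _ y0 yy'.
  rewrite mulr_le0_ge0 ?subr_ge0// pmulr_rle0//.
  have := powR_chord2 p1 pq y0 c1 (le_trans c2 yx').
  by rewrite -/s1 -/s2 -/S1 -/S2; lra.
have gx : 0 <= g x - g x'.
  have [c /andP[c1 c2] ->] := gE _ _ (le_trans y0 (ltW yltx')) x'x.
  rewrite mulr_ge0 ?subr_ge0// pmulr_rge0//.
  have := powR_chord2 p1 pq y0 (ltW yltx') c1.
  by rewrite -/s1 -/s2 -/S1 -/S2; lra.
have G : 0 <= a * (g x - g x') + b * (g y - g y') + (g r - g r').
  by apply: addr_ge0 => //; apply: addr_ge0; apply: mulr_ge0 => //; exact: ltW.
rewrite -subr_ge0 -(pmulr_rge0 _ s12).
suff <- : a * (g x - g x') + b * (g y - g y') + (g r - g r') =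
  (s2 - s1) * (a * x `^ q + b * y `^ q + r `^ q -
     (a * x' `^ q + b * y' `^ q + r' `^ q)) by [].
have su := congr1 (fun t => u * t) sE; have sv := congr1 (fun t => v * t) pE.
rewrite /= in su sv; rewrite /g; lra.
Qed.

(** First equalise the upper two values and lower [r'] from [r] to 0; the p-th power sum [G] starts
    at most at [P]. If [G 0] is at least [P], some [r'] fits. Otherwise put [r' = 0] and vary [y']
    between [y] and the common mean [M]. *)
Lemma smoothing_step p q a b x y r : 1 < p -> p < q -> 0 < a -> 0 < b ->
  0 <= r -> r <= y -> y <= x ->
  exists x' y' r', [/\ [/\ 0 <= r', r' <= y' & y' <= x'],
    x' = y' \/ r' = 0,
    a * x' + b * y' + r' = a * x + b * y + r,
    a * x' `^ p + b * y' `^ p + r' `^ p = a * x `^ p + b * y `^ p + r `^ p &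
    a * x' `^ q + b * y' `^ q + r' `^ q <= a * x `^ q + b * y `^ q + r `^ q].
Proof.
move=> p1 pq a0 b0 r0 ry; rewrite le_eqVlt => /predU1P[<-|yx].
  by exists y, y, r; split => //; left.
have p0 : 0 < p by lra.
have y0 : 0 <= y by lra.
have x0 : 0 <= x by lra.
pose S := a * x + b * y + r.
pose P := a * x `^ p + b * y `^ p + r `^ p.
pose M := S / (a + b).
have ab : a + b != 0 by lra.
have ME : a * M + b * M = S by rewrite /M; field.
have ayx : 0 < a * (x - y) by rewrite mulr_gt0// subr_gt0.
have abV : 0 < (a + b)^-1 by rewrite invr_gt0; lra.
have yM t : t <= r -> y <= M + - (a + b)^-1 * t.
  move=> tr; have -> : M + - (a + b)^-1 * t = (S - t) / (a + b).
    by rewrite /M; field.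
  by rewrite ler_pdivlMr ?addr_gt0// /S; lra.
pose G t := (a + b) * (M + - (a + b)^-1 * t) `^ p + 1 * t `^ p.
have [G0|G0] := leP P (G 0).
  have [||c /andP[c0 cr] cE] :=
      @powR_combination_IVT R p M (- (a + b)^-1) (a + b) 1 0 r P p0 (lexx _) r0.
  - by move=> t /andP[_ tr]; rewrite (le_trans y0)// yM.
  - rewrite -/(G r) -/(G 0) G0 andbT; apply/orP; right; rewrite /G mul1r.
    have := yM _ (lexx r); set m := M + _ => ym.
    have m0 : 0 <= m by lra.
    (* At [t = r] the value [m] is the weighted mean of [x] and [y], so the linear terms of the
       tangents at [m] cancel. *)
    have mE : a * (x - m) + b * (y - m) = 0.
      by rewrite /m /M /S; field.
    have hx := powR_tangent p1 m0 x0; rewrite -(ler_pM2l a0) in hx.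
    have hy := powR_tangent p1 m0 y0; rewrite -(ler_pM2l b0) in hy.
    have := congr1 (fun t => p * m `^ (p - 1) * t) mE.
    by rewrite /= mulr0 /P; move: hx hy; lra.
  have := yM _ cr; move: cE; set m := M + _ => cE ym.
  exists m, m, c.
  have sE : a * m + b * m + c = S by rewrite /m -ME; field.
  have pE : a * m `^ p + b * m `^ p + c `^ p = P by rewrite -cE; ring.
  split => //; [by split => //; lra|by left|].
  by apply: (contraction_powR_le p1 pq) => //; rewrite -/S -/P.
have a' : a != 0 by lra.
have MyM : y <= M by have := yM 0 r0; rewrite mulr0 addr0.
pose K t := a * (S / a + - (b / a) * t) `^ p + b * t `^ p.
have xE t : S / a + - (b / a) * t = (S - b * t) / a by field.
have MxE : S / a + - (b / a) * M = M by rewrite -ME; field.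
have Mx t : t <= M -> M <= S / a + - (b / a) * t.
  move=> tM; rewrite xE ler_pdivlMr//.
  have : b * t <= b * M by rewrite ler_pM2l.
  lra.
have [||c /andP[yc cM] cE] :=
    @powR_combination_IVT R p (S / a) (- (b / a)) a b y M P p0 y0 MyM.
- by move=> t /andP[_ tM]; have := Mx _ tM; lra.
- rewrite -/(K y) -/(K M); apply/orP; right; apply/andP; split.
    by apply/ltW; move: G0; rewrite /G /K MxE mulr0 addr0 powR0 ?gt_eqF//; lra.
  (* At [t = y] all of [r] is spread over the [a] copies of [x]; as [r <= x], the p-th power sum
     does not drop. *)
  have -> : K y = a * (x + r / a) `^ p + b * y `^ p.
    by congr (_ * _ `^ _ + _); rewrite /S; field.
  have xra : 0 <= x + r / a by rewrite addr_ge0// divr_ge0// ltW.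
  have := powR_tangent p1 x0 xra; rewrite -(ler_pM2l a0).
  rewrite (_ : a * (x `^ p + p * x `^ (p - 1) * (x + r / a - x)) =
    a * x `^ p + p * (r * x `^ (p - 1))); last by field.
  have : r `^ p <= p * (r * x `^ (p - 1)).
    rewrite -(mulr_powRB1 r0 p0).
    have : r * r `^ (p - 1) <= r * x `^ (p - 1).
      by rewrite ler_wpM2l// powR_le//; lra.
    have : 0 <= r * r `^ (p - 1) by rewrite mulr_ge0// powR_ge0.
    by move: (r * _) (r * _) => A B; nra.
  by rewrite /P; lra.
have := Mx _ cM; move: cE; set m := S / a + _ => cE Mm.
have sE : a * m + b * c + 0 = S by rewrite /m; field.
have pE : a * m `^ p + b * c `^ p + 0 `^ p = P.
  by rewrite powR0 ?gt_eqF// addr0.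
exists m, c, 0; split => //; [by split => //; lra|by right|].
by apply: (contraction_powR_le p1 pq) => //; rewrite -/S -/P; lra.
Qed.

End smoothing.

(** * Reduction of finite vectors to extremal form *)

Section extremal.
Context {R : realType}.
Implicit Types (p q a b x y r z C S P Q : R) (m n : nat) (w : nat -> R).

(* The vector with m + 1 entries z and one entry r has sum S, p-th power sum P
   and q-th power sum at most Q. *)
Definition extremal_below p q S P Q := exists m z r,
  [/\ 0 <= r, r <= z, m.+1%:R * z + r = S,
      m.+1%:R * z `^ p + r `^ p = P & m.+1%:R * z `^ q + r `^ q <= Q].

Lemma extremal_below_le p q S P Q Q' :
  extremal_below p q S P Q -> Q <= Q' -> extremal_below p q S P Q'.
Proof.
move=> [m [z [r [? ? ? ? h]]]] QQ'; exists m, z, r; split => //.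
exact: le_trans QQ'.
Qed.

(* When the smoothing step empties the last entry, one of the middle entries
   takes its place and there is one middle entry less. *)
Lemma extremal_below_top p q m x z r : 1 < p -> p < q ->
  0 <= r -> r <= z -> z <= x ->
  extremal_below p q (x + m%:R * z + r) (x `^ p + m%:R * z `^ p + r `^ p)
    (x `^ q + m%:R * z `^ q + r `^ q).
Proof.
move=> p1 pq; elim: m x z r => [|m IH] x z r r0 rz zx.
  by exists 0%N, x, r; split; rewrite ?mul0r ?addr0 ?mul1r//; lra.
have m0 : 0 < m.+1%:R :> R by rewrite ltr0n.
have [x' [y' [r' [[r'0 ry' yx'] xr' sE pE qE]]]] :=
  smoothing_step p1 pq ltr01 m0 r0 rz zx.
rewrite !mul1r in sE pE qE.
case: xr' => [xy'|r'E]; subst.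
  exists m.+1, y', r'; rewrite -(natr1 m.+1).
  by split => //; rewrite -?sE -?pE; lra.
rewrite -sE -pE; apply: extremal_below_le qE.
have p0 : p != 0 by lra.
have q0 : q != 0 by lra.
rewrite !powR0// -natr1 !mulrDl !mul1r !addr0 !addrA.
exact: IH.
Qed.

(** An entry above [z] is a top entry for [extremal_below_top]. Otherwise [x] and [r], sorted, are
    the lower two values of one smoothing step, which ends with [m.+2] equal entries or with
    remainder [y']. *)
Lemma extremal_below_add p q S P Q x : 1 < p -> p < q -> 0 <= x ->
  extremal_below p q S P Q ->
  extremal_below p q (S + x) (P + x `^ p) (Q + x `^ q).
Proof.
move=> p1 pq x0 [m [z [r [r0 rz <- <- qE]]]].
have [zx|xz] := ltP z x.
  have := extremal_below_top m.+1 p1 pq r0 rz (ltW zx).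
  have E (u v t : R) : u + v + t = v + t + u by rewrite -addrA addrC.
  rewrite (E x) (E (x `^ p)) (E (x `^ q)) => h.
  by apply: extremal_below_le h _; rewrite lerD2r.
have m0 : 0 < m.+1%:R :> R by rewrite ltr0n.
have p0 : p != 0 by lra.
have q0 : q != 0 by lra.
have key y s : 0 <= s -> s <= y -> y <= z ->
    extremal_below p q (m.+1%:R * z + y + s)
      (m.+1%:R * z `^ p + y `^ p + s `^ p) (m.+1%:R * z `^ q + y `^ q + s `^ q).
  move=> s0 sy yz.
  have [x' [y' [r' [[r'0 ry' yx'] xr' sE pE qE']]]] :=
    smoothing_step p1 pq m0 ltr01 s0 sy yz.
  rewrite !mul1r in sE pE qE'.
  rewrite -sE -pE; apply: extremal_below_le qE'.
  case: xr' => [xy'|r'E]; subst.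
    exists m.+1, y', r'; rewrite -(natr1 m.+1).
    by split => //; lra.
  by exists m, x', y'; split; rewrite ?powR0 ?addr0.
have [xr|rx] := leP x r.
  by apply: extremal_below_le (key _ _ x0 xr rz) _; rewrite lerD2r.
rewrite (addrAC _ r) (addrAC _ (r `^ p)).
apply: extremal_below_le (key _ _ r0 (ltW rx) xz) _.
by rewrite addrAC lerD2r.
Qed.

Lemma extremal_below_sum p q w n : 1 < p -> p < q -> (forall i, 0 <= w i) ->
  extremal_below p q (\sum_(0 <= i < n) w i) (\sum_(0 <= i < n) w i `^ p)
    (\sum_(0 <= i < n) w i `^ q).
Proof.
move=> p1 pq w0; elim: n => [|n IH]; last first.
  by rewrite !big_nat_recr//=; exact: extremal_below_add.
rewrite !big_geq//; exists 0%N, 0, 0.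
by rewrite !powR0 ?mulr0 ?addr0//; lra.
Qed.

(** A remainder equal to [z] counts as one more full entry. Strictness makes [m.+1] the floor of
    [z^-1] when [S = 1]. *)
Lemma extremal_below_lt p q S P Q : 0 < p -> 0 < q -> 0 < S ->
  extremal_below p q S P Q -> exists m z r,
  [/\ 0 <= r < z, m.+1%:R * z + r = S,
      m.+1%:R * z `^ p + r `^ p = P & m.+1%:R * z `^ q + r `^ q <= Q].
Proof.
move=> p0 q0 S0 [m [z [r [r0]]]].
rewrite le_eqVlt => /predU1P[-> sE pE qE|rz sE pE qE]; last first.
  by exists m, z, r; rewrite r0 rz.
exists m.+1, z, 0; rewrite -(natr1 m.+1) !powR0 ?gt_eqF// lexx/=.
split; try lra.
rewrite ltNge; apply/negP => z0.
have : m.+1%:R * z <= 0 by rewrite mulr_ge0_le0.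
lra.
Qed.

Lemma phi_extremal p m z r : 0 <= r < z -> m.+1%:R * z + r = 1 ->
  phi p z = m.+1%:R * z `^ p + r `^ p.
Proof.
move=> /andP[r0 rz] sE; have z0 : 0 < z by lra.
have fE : Num.floor z^-1 = m.+1%:Z.
  apply/floor_def; rewrite intrD -pmulrn -[z^-1]mul1r.
  by rewrite ler_pdivlMr// ltr_pdivrMr// mulrDl mul1r; lra.
by rewrite /phi fE -pmulrn; congr (_ + _ `^ _); lra.
Qed.

Lemma extremal_unit_range m z r : 0 <= r < z -> m.+1%:R * z + r = 1 -> 0 < z <= 1.
Proof.
move=> /andP[r0 rz] sE; have z0 : 0 < z by lra.
rewrite z0/=; have : 1 * z <= m.+1%:R * z by rewrite ler_pM2r// ler1n.
lra.
Qed.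

(** Between the unit vector and [K] equal entries, some vector of [K] entries [y] and one entry
    [1 - K * y] has p-th power sum [C]; smoothing brings it to extremal form. *)
Lemma phi_surj p C : 1 < p -> 0 < C -> C < 1 -> exists m z r,
  [/\ 0 <= r < z, m.+1%:R * z + r = 1 & m.+1%:R * z `^ p + r `^ p = C].
Proof.
move=> p1 C0 C1; have p0 : 0 < p by lra.
pose X := C `^ (p - 1)^-1.
have X0 : 0 < X by exact: powR_gt0.
have XV : 0 <= X^-1 by rewrite invr_ge0 ltW.
have [[|k] kX] : exists k : nat, X^-1 < k%:R.
- by exists (Num.bound X^-1); exact: archi_boundP.
- by move: kX; rewrite ltNge XV.
pose K : R := k.+1%:R.
have K0 : 0 < K by rewrite ltr0n.
have KV0 : 0 <= K^-1 by rewrite invr_ge0 ltW.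
have KX : K^-1 <= X by rewrite invf_ple// ltW.
have KC : K * K^-1 `^ p <= C.
  rewrite -(mulr_powRB1 KV0 p0) mulrA mulfV ?gt_eqF// mul1r.
  have -> : C = X `^ (p - 1) by rewrite /X -powRrM mulVf ?powRr1//; lra.
  by apply: powR_le => //; lra.
have [||y /andP[y0 yK] yE] :=
  @powR_combination_IVT R p 1 (- K) 1 K 0 K^-1 C p0 (lexx _) KV0.
- move=> t /andP[_ tK]; have := tK; rewrite -(ler_pM2l K0) mulfV ?gt_eqF//; lra.
- rewrite mulr0 addr0 powR1 powR0 ?gt_eqF// mulNr mulfV ?gt_eqF// subrr.
  by rewrite powR0 ?gt_eqF// !mulr0 add0r addr0 KC mulr1 (ltW C1) orbT.
(* Any exponent above [p] would do here: only the p-th power sum is kept. *)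
have p2 : p < p + 1 by lra.
have q0 : 0 < p + 1 by lra.
have Ky : 0 <= 1 + - K * y.
  by have := yK; rewrite -(ler_pM2l K0) mulfV ?gt_eqF//; lra.
have h : extremal_below p (p + 1) (K * y + 0) (K * y `^ p + 0 `^ p)
    (K * y `^ (p + 1) + 0 `^ (p + 1)) by exists k, y, 0.
have := extremal_below_add p1 p2 Ky h.
rewrite (_ : K * y + 0 + _ = 1); last by lra.
rewrite (_ : K * y `^ p + _ + _ = C); last by rewrite -yE powR0 ?gt_eqF//; lra.
move=> /(extremal_below_lt p0 q0 ltr01)[m [z [r [rz sE pE _]]]].
by exists m, z, r.
Qed.

End extremal.

(** * Passage to infinite vectors *)

Section series.
Context {R : realType}.
Implicit Types (p q C z r : R) (w : nat -> R).

Lemma prob_vector_partial_le1 w n : prob_vector w -> \sum_(0 <= i < n) w i <= 1.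
Proof.
move=> [w0 w1]; rewrite -lee_fin -sumEFin -w1.
by apply: nneseries_lim_ge => i _ _; rewrite lee_fin.
Qed.

Lemma prob_vector_tail_lt w e : prob_vector w -> 0 < e ->
  exists n, 1 - \sum_(0 <= i < n) w i < e.
Proof.
move=> [w0 w1] e0; apply: contrapT => /forallNP h.
suff : (1%:E <= (1 - e)%:E :> \bar R)%E by rewrite lee_fin; lra.
rewrite -w1; apply: lime_le.
  by apply: is_cvg_nneseries => i _ _; rewrite lee_fin.
apply: nearW => n; rewrite sumEFin lee_fin.
by have /negP := h n; rewrite -leNgt; lra.
Qed.

(* The entries from index n on are bounded by their sum t, whence
   w i `^ p <= t `^ (p - 1) * w i. *)
Lemma power_sum_le_lump p w n : 1 < p -> prob_vector w ->
  (power_sum p w <= (\sum_(0 <= i < n) w i `^ p +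
                     (1 - \sum_(0 <= i < n) w i) `^ p)%:E)%E.
Proof.
move=> p1 pw; have [w0 _] := pw.
have p0 : 0 < p by lra.
pose t := 1 - \sum_(0 <= i < n) w i.
have t0 : 0 <= t by rewrite subr_ge0 prob_vector_partial_le1.
have tailE N : (n <= N)%N -> \sum_(n <= i < N) w i <= t.
  move=> nN; have := prob_vector_partial_le1 N pw.
  by rewrite (big_cat_nat (leq0n n) nN)/= /t; lra.
have wt i : (n <= i)%N -> w i <= t.
  move=> ni; have := tailE i.+1 (leqW ni); apply: le_trans.
  by rewrite big_nat_recr//= lerDr sumr_ge0.
apply: lime_le.
  by apply: is_cvg_nneseries => i _ _; rewrite lee_fin powR_ge0.
exists n => // N /= nN; rewrite sumEFin lee_fin (big_cat_nat (leq0n n) nN)/= lerD2l.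
rewrite -/t -(mulr_powRB1 t0 p0) mulrC.
apply: (@le_trans _ _ (\sum_(n <= i < N) t `^ (p - 1) * w i)).
  apply: ler_sum_nat => i /andP[ni _].
  rewrite -(mulr_powRB1 (w0 i) p0) mulrC ler_wpM2r//.
  by apply: powR_le => //; [lra|exact: wt].
by rewrite -mulr_sumr ler_wpM2l ?powR_ge0// tailE.
Qed.

Lemma extremal_le_power_sum p q C m z r w : 1 < p -> p < q ->
  0 <= r < z -> m.+1%:R * z + r = 1 -> m.+1%:R * z `^ p + r `^ p = C ->
  admissible p C w ->
  ((m.+1%:R * z `^ q + r `^ q)%:E <= power_sum q w)%E.
Proof.
move=> p1 pq rz sE pE [pw wC]; have [w0 _] := pw.
have p0 : 0 < p by lra.
have q0 : 0 < q by lra.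
apply/lee_addgt0Pr => e e0.
have [n ne] := prob_vector_tail_lt pw e0.
have := power_sum_le_lump n p1 pw; rewrite wC lee_fin.
have := prob_vector_partial_le1 n pw.
have : 0 <= \sum_(0 <= i < n) w i by exact: sumr_ge0.
have := extremal_below_sum n p1 pq w0; move: ne.
set S := \sum_(0 <= i < n) w i; set P := \sum_(0 <= i < n) w i `^ p.
set Q := \sum_(0 <= i < n) w i `^ q => ne SPQ S0 S1 CP.
have t0 : 0 <= 1 - S by lra.
have := extremal_below_add p1 pq t0 SPQ; rewrite addrC subrK.
move=> /(extremal_below_lt p0 q0 ltr01)[m' [z' [r' [rz' sE' pE' qE']]]].
have QQ : (Q%:E <= power_sum q w)%E.
  rewrite /Q -sumEFin; apply: nneseries_lim_ge => i _ _.
  by rewrite lee_fin powR_ge0.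
apply: le_trans (leeD2r _ QQ); rewrite -EFinD lee_fin.
have tq : (1 - S) `^ q <= e.
  rewrite -(mulr_powRB1 t0 q0).
  have : (1 - S) `^ (q - 1) <= 1 `^ (q - 1) by apply: powR_le; lra.
  by rewrite powR1 => h; have := ler_wpM2l t0 h; lra.
have /andP[z0 z1] := extremal_unit_range rz sE.
have /andP[z'0 z'1] := extremal_unit_range rz' sE'.
have q1 : 1 < q by lra.
rewrite -(phi_extremal q rz sE); rewrite -(phi_extremal q rz' sE') in qE'.
(* Lumping gives [phi p z <= phi p z']; strict monotonicity for [p] yields [z <= z'], and that for
   [q] concludes. *)
suff : phi q z <= phi q z' by lra.
have [zz'|zz'|->//] := ltgtP z z'; first by rewrite ltW// phi_lt.
have := phi_lt p1 z'0 zz' z1.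
by rewrite (phi_extremal p rz sE) (phi_extremal p rz' sE') pE pE'; lra.
Qed.

(** Here [m] is the exact number of entries [z], whereas [extremal_below] has [m.+1] of them. *)
Definition extremal_vector m z r (i : nat) : R :=
  if (i < m)%N then z else if i == m then r else 0.

(** A general [F] covers both the sum and the power sums; the partial sums are eventually
    constant. *)
Lemma extremal_vector_sum (F : R -> R) m z r : F 0 = 0 ->
  (\sum_(0 <= i <oo) (F (extremal_vector m z r i))%:E = (m%:R * F z + F r)%:E)%E.
Proof.
move=> F0; apply: lim_near_cst => //; exists m.+1 => // n /= mn.
rewrite sumEFin (big_cat_nat (leq0n _) mn)/= big_nat_recr//=.
rewrite /extremal_vector ltnn eqxx (eq_big_nat _ _ (F2 := fun=> F z)); last first.
  by move=> i /andP[_ ->].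
rewrite sumr_const_nat subn0 -[F z *+ m]mulr_natl big_nat big1 ?addr0//.
by move=> i /andP[mi _]; rewrite ltnNge (ltnW mi)/= gtn_eqF.
Qed.

End series.

Theorem theorem1p4 (R : realType) (p q C : R) :
  1 < p -> p < q -> 0 < C -> C < 1 ->
  (forall w : nat -> R, admissible p C w ->
     ((fpq p q C)%:E <= power_sum q w)%E) /\
  (exists (w : nat -> R) (m : nat),
     [/\ admissible p C w,
         power_sum q w = (fpq p q C)%:E,
         (0 < m)%N /\ (forall i : nat, (i < m)%N -> w i = w 0%N),
         w m < w 0%N /\ 0 <= w m &
         (forall i : nat, (m < i)%N -> w i = 0)]).
Proof.
move=> p1 pq C0 C1; have [m [z [r [rz sE pE]]]] := phi_surj p1 C0 C1.
have fE : fpq p q C = m.+1%:R * z `^ q + r `^ q.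
  rewrite -(phi_extremal q rz sE) -(fpq_phi q p1 (extremal_unit_range rz sE)).
  by rewrite (phi_extremal p rz sE) pE.
have pn : p != 0 by lra.
have qn : q != 0 by lra.
have /andP[r0 rltz] := rz.
rewrite fE; split => [w|]; first exact: extremal_le_power_sum.
exists (extremal_vector m.+1 z r), m.+1; split.
- split; last by rewrite /power_sum (@extremal_vector_sum _ (@powR R ^~ p)) ?powR0 ?pE.
  split; last by rewrite (@extremal_vector_sum _ id) ?sE.
  move=> i; rewrite /extremal_vector; case: ifP => // _; first lra.
  by case: ifP.
- by rewrite /power_sum (@extremal_vector_sum _ (@powR R ^~ q)) ?powR0.
- by split => // i im; rewrite /extremal_vector im.
- by rewrite /extremal_vector ltnn eqxx.
- by move=> i mi; rewrite /extremal_vector ltnNge (ltnW mi)/= gtn_eqF.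
Qed.
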